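(* Let $(U,\tau_1,A)$ and $(V,\tau_2,B)$ be soft connected soft topological spaces. Then their soft product topological space $(U\times V,\tau,A\times B)$ is soft connected.
   Context: Let $X$ be a set and $E$ a set of parameters. A soft set $(F,E)$ over $X$ is a map $F:E\to\mathcal{P}(X)$; $SS(X)_E$ is the family of all of them. Unions and intersections are taken parameterwise. $\Phi_E$ is the null soft set $e\mapsto\emptyset$, and $\widetilde{X}$ is the soft set $e\mapsto X$. A soft topological space $(X,\tau,E)$ is given by a family $\tau\subseteq SS(X)_E$ containing $\Phi_E$ and $\widetilde{X}$ and closed under arbitrary unions and finite intersections; members of $\tau$ are called soft open. A soft separation of $\widetilde{X}$ is a pair of soft open sets, both different from $\Phi_E$, whose union is $\widetilde{X}$ and whose intersection is $\Phi_E$. The space is soft connected if no soft separation of $\widetilde{X}$ exists. For $(F,A)\in SS(U)_A$ and $(G,B)\in SS(V)_B$, the cartesian product $(F,A)\times(G,B)=(F\times G,A\times B)\in SS(U\times V)_{A\times B}$ is defined by $(F\times G)(a,b)=F(a)\times G(b)$. The soft product topology $\tau$ over $U\times V$ is the collection of all arbitrary unions of soft sets of the form $(F,A)\times(G,B)$ with $(F,A)\in\tau_1$ and $(G,B)\in\tau_2$. *)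

(* Defs.v *)
From mathcomp Require Import all_boot.
From mathcomp Require Import boolp classical_sets.

Set Implicit Arguments.
Unset Strict Implicit.
Unset Printing Implicit Defensive.

Local Open Scope classical_set_scope.

Definition soft_set (X E : Type) : Type := E -> set X.

Section SoftSets.
Variables X E : Type.
Implicit Types (F G : soft_set X E) (D : set (soft_set X E)).

Definition soft_null : soft_set X E := fun _ => set0.

Definition soft_full : soft_set X E := fun _ => setT.

Definition soft_union F G : soft_set X E := fun e => F e `|` G e.

Definition soft_inter F G : soft_set X E := fun e => F e `&` G e.

Definition soft_bigunion D : soft_set X E := fun e => \bigcup_(F in D) F e.

End SoftSets.

Arguments soft_null {X E}.
Arguments soft_full {X E}.

(* Closure under finite intersections is closure under binary ones, the empty
   intersection being the full soft set. *)
Record soft_topology (X E : Type) := SoftTopology {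
  soft_open : set (soft_set X E);
  soft_open_null : soft_open soft_null;
  soft_open_full : soft_open soft_full;
  soft_open_bigunion : forall D : set (soft_set X E),
    D `<=` soft_open -> soft_open (soft_bigunion D);
  soft_open_inter : forall F G : soft_set X E,
    soft_open F -> soft_open G -> soft_open (soft_inter F G)
}.

Definition soft_separation (X E : Type) (tau : soft_topology X E)
    (F G : soft_set X E) : Prop :=
  [/\ soft_open tau F /\ soft_open tau G,
      F <> soft_null /\ G <> soft_null,
      soft_union F G = soft_full
    & soft_inter F G = soft_null].

Definition soft_connected (X E : Type) (tau : soft_topology X E) : Prop :=
  ~ exists F G : soft_set X E, soft_separation tau F G.

Definition soft_prod (U V A B : Type) (F : soft_set U A) (G : soft_set V B) :
    soft_set (U * V) (A * B) :=
  fun ab => F ab.1 `*` G ab.2.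

Section SoftProductTopology.
Variables (U V A B : Type).
Variables (tau1 : soft_topology U A) (tau2 : soft_topology V B).

Definition soft_open_boxes : set (soft_set (U * V) (A * B)) :=
  [set H | exists F G,
    [/\ soft_open tau1 F, soft_open tau2 G & H = soft_prod F G]].

Definition soft_product_open : set (soft_set (U * V) (A * B)) :=
  [set H | exists2 D, D `<=` soft_open_boxes & H = soft_bigunion D].

Lemma soft_product_open_null : soft_product_open soft_null.
Proof.
exists set0; first by move=> H [].
by apply/funext => ab; rewrite /soft_bigunion bigcup_set0.
Qed.

Lemma soft_product_open_full : soft_product_open soft_full.
Proof.
exists [set soft_prod soft_full soft_full].
  move=> _ ->; exists soft_full, soft_full.
  by split=> //; exact: soft_open_full.
by apply/funext => ab; rewrite /soft_bigunion bigcup_set1 /soft_prod setXTT.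
Qed.

Lemma soft_product_open_bigunion (D : set (soft_set (U * V) (A * B))) :
  D `<=` soft_product_open -> soft_product_open (soft_bigunion D).
Proof.
move=> Dopen.
exists [set K | soft_open_boxes K /\
  exists2 H, D H & forall ab, K ab `<=` H ab]; first by move=> K [].
apply/funext => ab; apply/seteqP; split=> x.
  move=> [H DH Hx]; have [C Cbox HE] := Dopen _ DH.
  move: Hx; rewrite HE => -[K CK Kx]; exists K => //; split; first exact: Cbox.
  by exists H => // cd y Ky; rewrite HE; exists K.
by move=> [K [_ [H DH KH]] Kx]; exists H => //; exact: KH.
Qed.

Lemma soft_product_open_inter (H K : soft_set (U * V) (A * B)) :
  soft_product_open H -> soft_product_open K ->
  soft_product_open (soft_inter H K).
Proof.
move=> [C Cbox ->] [D Dbox ->].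
exists [set L | exists H' K', [/\ C H', D K' & L = soft_inter H' K']].
  move=> _ [H' [K' [/Cbox [F [G [oF oG ->]]] /Dbox [F' [G' [oF' oG' ->]]] ->]]].
  exists (soft_inter F F'), (soft_inter G G').
  split; [exact: soft_open_inter|exact: soft_open_inter|].
  by apply/funext => ab; rewrite /soft_inter /soft_prod setXI.
apply/funext => ab; apply/seteqP; split=> x.
  by move=> [[H' CH' H'x] [K' DK' K'x]]; exists (soft_inter H' K') => //; exists H', K'.
by move=> [_ [H' [K' [CH' DK' ->]]] [H'x K'x]]; split; [exists H'|exists K'].
Qed.

Definition soft_product_topology : soft_topology (U * V) (A * B) :=
  SoftTopology soft_product_open_null soft_product_open_full
    soft_product_open_bigunion soft_product_open_inter.

End SoftProductTopology.

(* Main.v *)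
(** A soft topology over [X] with parameters [E] is a topology on [E * X], and
    the soft product is the product topology. A separation of the product pulls
    back along each horizontal or vertical slice to two disjoint soft open sets
    covering a connected factor, so no slice meets both halves. But any two
    points are joined by a horizontal slice followed by a vertical one. *)

Require Import Defs.
From mathcomp Require Import all_boot.
From mathcomp Require Import boolp classical_sets.

Local Open Scope classical_set_scope.

(** With soft sets read as subsets of [E * X], this is the preimage under the map sending [(e, x)]
    to [(p e, f x)]. *)
Definition soft_preimage {X Y E E' : Type} (f : X -> Y) (p : E -> E')
    (H : soft_set Y E') : soft_set X E :=
  fun e => f @^-1` H (p e).

Definition soft_continuous {X Y E E' : Type} (tau : soft_topology X E)
    (sigma : soft_topology Y E') (f : X -> Y) (p : E -> E') : Prop :=
  forall H, soft_open sigma H -> soft_open tau (soft_preimage f p H).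

(** If the second point lay in [K], the preimages of [H] and [K] would separate the connected
    source, with [x] and [x'] witnessing that they are non-null. *)
Lemma soft_connected_image_sub {X Y E E' : Type} {tau : soft_topology X E}
    {sigma : soft_topology Y E'} {f : X -> Y} {p : E -> E'}
    {H K : soft_set Y E'} :
  soft_connected tau -> soft_continuous tau sigma f p ->
  soft_separation sigma H K ->
  forall {e} e' {x} x', H (p e) (f x) -> H (p e') (f x').
Proof.
move=> conn cont [[oH oK] _ HUK HIK] e e' x x' Hx.
have: soft_union H K (p e') (f x') by rewrite HUK.
case=> // Kx'; case: conn.
exists (soft_preimage f p H), (soft_preimage f p K); split.
- by split; exact: cont.
- split=> null.
    by have: soft_preimage f p H e x by []; rewrite null.
  by have: soft_preimage f p K e' x' by []; rewrite null.
- apply/funext => a; apply/seteqP; split=> // y _.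
  by change (soft_union H K (p a) (f y)); rewrite HUK.
- apply/funext => a; apply/seteqP; split=> // y HKy.
  by have: soft_inter H K (p a) (f y) by []; rewrite HIK.
Qed.

(** Preimages commute with unions, and every open set of the product is a union of boxes. *)
Lemma soft_product_continuous {X E U V A B : Type} (tau : soft_topology X E)
    (tau1 : soft_topology U A) (tau2 : soft_topology V B)
    (f : X -> U * V) (p : E -> A * B) :
  (forall F G, soft_open tau1 F -> soft_open tau2 G ->
    soft_open tau (soft_preimage f p (soft_prod F G))) ->
  soft_continuous tau (soft_product_topology tau1 tau2) f p.
Proof.
move=> box _ [D Dbox ->].
have -> : soft_preimage f p (soft_bigunion D) =
    soft_bigunion (soft_preimage f p @` D).
  by apply/funext => e; rewrite /soft_bigunion bigcup_image.
apply: soft_open_bigunion => _ [H /Dbox [F [G [oF oG ->]]] <-]; exact: box.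
Qed.

(** A horizontal slice meets the box of [F] and [G] in a copy of [F] when [v] lies in [G b], and in
    nothing otherwise. *)
Lemma soft_continuous_pairr {U V A B : Type} (tau1 : soft_topology U A)
    (tau2 : soft_topology V B) (v : V) (b : B) :
  soft_continuous tau1 (soft_product_topology tau1 tau2)
    (fun u => (u, v)) (fun a => (a, b)).
Proof.
apply: soft_product_continuous => F G oF _.
have [Gv|nGv] := pselect (G b v).
  suff -> : soft_preimage (fun u => (u, v)) (fun a => (a, b)) (soft_prod F G) = F
    by [].
  by apply/funext => a; apply/seteqP; split=> u // [].
suff -> : soft_preimage (fun u => (u, v)) (fun a => (a, b)) (soft_prod F G) =
  soft_null by exact: soft_open_null.
by apply/funext => a; apply/seteqP; split=> u // [].
Qed.

Lemma soft_continuous_pairl {U V A B : Type} (tau1 : soft_topology U A)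
    (tau2 : soft_topology V B) (u : U) (a : A) :
  soft_continuous tau2 (soft_product_topology tau1 tau2) (pair u) (pair a).
Proof.
apply: soft_product_continuous => F G _ oG.
have [Fu|nFu] := pselect (F a u).
  suff -> : soft_preimage (pair u) (pair a) (soft_prod F G) = G by [].
  by apply/funext => b; apply/seteqP; split=> v // [].
suff -> : soft_preimage (pair u) (pair a) (soft_prod F G) = soft_null
  by exact: soft_open_null.
by apply/funext => b; apply/seteqP; split=> v // [].
Qed.

Lemma soft_neq_null {X E : Type} {F : soft_set X E} :
  F <> soft_null -> exists e x, F e x.
Proof.
move=> Fn0; apply: contrapT => nF; apply: Fn0; apply/funext => e.
by apply/seteqP; split=> // x Fx; apply: nF; exists e, x.
Qed.

Theorem theorem2p29 (U V A B : Type)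
    (tau1 : soft_topology U A) (tau2 : soft_topology V B) :
  soft_connected tau1 -> soft_connected tau2 ->
  soft_connected (soft_product_topology tau1 tau2).
Proof.
move=> conn1 conn2 [H [K sep]].
have [_ [Hn0 Kn0] _ HIK] := sep.
have [[a b] [[u v] Hab]] := soft_neq_null Hn0.
have [[a' b'] [[u' v'] Kab']] := soft_neq_null Kn0.
(* The corner shares [b] and [v] with the point of [H], and [a'] and [u'] with the point of [K], so
   each is joined to it by one slice. *)
have Ha'b : H (a', b) (u', v) := soft_connected_image_sub conn1
  (soft_continuous_pairr _ tau2 v b) sep a' u' Hab.
have Ha'b' : H (a', b') (u', v') := soft_connected_image_sub conn2
  (soft_continuous_pairl tau1 _ u' a') sep b' v' Ha'b.
by have: soft_inter H K (a', b') (u', v') by []; rewrite HIK.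
Qed.
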